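(* Let $n\ge1$ and $\mathbf{P}_A,\mathbf{P}_B,\mathbf{Q}_A,\mathbf{Q}_B\in\mathbb{R}^{n\times n}$ be symmetric positive definite. Let $\omega_1\in[0,1]$. Then $\mathcal{E}(\mathbf{B}_{\mathrm{SCI}}(\omega_1))$ tightly circumscribes $\mathcal{V}^*$ if and only if there exists $\mathbf{x}\neq\mathbf{0}$ such that $g(\mathbf{x})=\mathbf{x}^\intercal\mathbf{H}_{\mathrm{SCI}}(\omega_1)\mathbf{x}$.
   Context: $\mathbf{C}_A=\mathbf{P}_A+\mathbf{Q}_A$, $\mathbf{C}_B=\mathbf{P}_B+\mathbf{Q}_B$. For $\omega\in[0,1]$, $\bar\omega=1-\omega$: $\mathbf{H}_{\mathrm{SCI}}(\omega)=\omega(\mathbf{P}_A+\omega\mathbf{Q}_A)^{-1}+\bar\omega(\mathbf{P}_B+\bar\omega\mathbf{Q}_B)^{-1}$ and $\mathbf{B}_{\mathrm{SCI}}(\omega)=\mathbf{H}_{\mathrm{SCI}}(\omega)^{-1}$. $\mathcal{A}_{\mathrm{Split}}=\{\mathbf{M} : \begin{bmatrix}\mathbf{P}_A & \mathbf{M}\\ \mathbf{M}^\intercal & \mathbf{P}_B\end{bmatrix}\succeq 0\}$. $\mathbf{C}_F(\mathbf{K},\mathbf{P}_{AB})=\mathbf{K}_A\mathbf{C}_A\mathbf{K}_A^\intercal+\mathbf{K}_A\mathbf{P}_{AB}\mathbf{K}_B^\intercal+\mathbf{K}_B\mathbf{P}_{AB}^\intercal\mathbf{K}_A^\intercal+\mathbf{K}_B\mathbf{C}_B\mathbf{K}_B^\intercal$.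 For $\mathbf{P}_{AB}\in\mathcal{A}_{\mathrm{Split}}$: $\mathbf{R}=\mathbf{C}_A+\mathbf{C}_B-\mathbf{P}_{AB}-\mathbf{P}_{AB}^\intercal$, $\mathbf{K}_A^*=(\mathbf{C}_B-\mathbf{P}_{AB}^\intercal)\mathbf{R}^{-1}$, $\mathbf{C}_F^*(\mathbf{P}_{AB})=\mathbf{C}_F((\mathbf{K}_A^*,\mathbf{I}-\mathbf{K}_A^* ),\mathbf{P}_{AB})$, $\mathbf{M}_F^*(\mathbf{P}_{AB})=\mathbf{C}_F^*(\mathbf{P}_{AB})^{-1}$. $g(\mathbf{x})=\min_{\mathbf{P}_{AB}\in\mathcal{A}_{\mathrm{Split}}}\mathbf{x}^\intercal\mathbf{M}_F^*(\mathbf{P}_{AB})\mathbf{x}$. For symmetric positive definite $\mathbf{P}$, $\mathcal{E}(\mathbf{P})=\{\mathbf{x}:\mathbf{x}^\intercal\mathbf{P}^{-1}\mathbf{x}\le1\}$; $\mathcal{V}^*=\bigcup_{\mathbf{P}_{AB}\in\mathcal{A}_{\mathrm{Split}}}\mathcal{E}(\mathbf{C}_F^*(\mathbf{P}_{AB}))$. $\mathcal{E}(\mathbf{P})$ tightly circumscribes $\mathcal{V}^*$ if $\mathcal{V}^*\subseteq\mathcal{E}(\mathbf{P})$ and for every symmetric positive definite $\mathbf{Q}$, $\mathcal{V}^*\subseteq\mathcal{E}(\mathbf{Q})\subseteq\mathcal{E}(\mathbf{P})$ implies $\mathbf{Q}=\mathbf{P}$. *)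

(* Defs.v *)
From HB Require Import structures.
From mathcomp Require Import all_boot all_order all_algebra.
From mathcomp Require Import all_classical all_reals.
Set Implicit Arguments. Unset Strict Implicit. Unset Printing Implicit Defensive.
Import Order.TTheory GRing.Theory Num.Theory.
Local Open Scope ring_scope.
Local Open Scope classical_set_scope.

Definition qf {R : realType} {n : nat} (A : 'M[R]_n) (x : 'cV[R]_n) : R :=
  (x^T *m A *m x) 0 0.

Definition sym_pd {R : realType} {n : nat} (A : 'M[R]_n) : Prop :=
  A^T = A /\ forall x : 'cV[R]_n, x != 0 -> 0 < qf A x.

Definition psd {R : realType} {n : nat} (A : 'M[R]_n) : Prop :=
  forall x : 'cV[R]_n, 0 <= qf A x.

Definition H_SCI {R : realType} {n : nat} (PA PB QA QB : 'M[R]_n) (w : R) : 'M[R]_n :=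
  w *: invmx (PA + w *: QA) + (1 - w) *: invmx (PB + (1 - w) *: QB).

Definition B_SCI {R : realType} {n : nat} (PA PB QA QB : 'M[R]_n) (w : R) : 'M[R]_n :=
  invmx (H_SCI PA PB QA QB w).

Definition A_Split {R : realType} {n : nat} (PA PB : 'M[R]_n) : set 'M[R]_n :=
  [set M | psd (block_mx PA M M^T PB)].

Definition C_F {R : realType} {n : nat} (CA CB KA KB PAB : 'M[R]_n) : 'M[R]_n :=
  KA *m CA *m KA^T + KA *m PAB *m KB^T + KB *m PAB^T *m KA^T + KB *m CB *m KB^T.

Definition R_mat {R : realType} {n : nat} (PA PB QA QB PAB : 'M[R]_n) : 'M[R]_n :=
  (PA + QA) + (PB + QB) - PAB - PAB^T.

Definition KA_star {R : realType} {n : nat} (PA PB QA QB PAB : 'M[R]_n) : 'M[R]_n :=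
  ((PB + QB) - PAB^T) *m invmx (R_mat PA PB QA QB PAB).

Definition C_F_star {R : realType} {n : nat} (PA PB QA QB PAB : 'M[R]_n) : 'M[R]_n :=
  let K := KA_star PA PB QA QB PAB in
  C_F (PA + QA) (PB + QB) K (1%:M - K) PAB.

Definition M_F_star {R : realType} {n : nat} (PA PB QA QB PAB : 'M[R]_n) : 'M[R]_n :=
  invmx (C_F_star PA PB QA QB PAB).

(* g(x) = min over A_Split (the minimum is attained; we write it as inf) *)
Definition g_fun {R : realType} {n : nat} (PA PB QA QB : 'M[R]_n) (x : 'cV[R]_n) : R :=
  inf [set qf (M_F_star PA PB QA QB PAB) x | PAB in A_Split PA PB].

Definition ellipsoid {R : realType} {n : nat} (P : 'M[R]_n) : set 'cV[R]_n :=
  [set x | qf (invmx P) x <= 1].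

Definition V_star {R : realType} {n : nat} (PA PB QA QB : 'M[R]_n) : set 'cV[R]_n :=
  \bigcup_(PAB in A_Split PA PB) ellipsoid (C_F_star PA PB QA QB PAB).

Definition tightly_circumscribes {R : realType} {n : nat}
    (P : 'M[R]_n) (V : set 'cV[R]_n) : Prop :=
  V `<=` ellipsoid P /\
  forall Q : 'M[R]_n, sym_pd Q -> V `<=` ellipsoid Q -> ellipsoid Q `<=` ellipsoid P -> Q = P.

(* Main.v *)
(** By least-squares duality, [qf (M_F_star M) x] is the maximum over [u, v] of
    [2 (u + v)^T x - joint_qf M u v].  Testing it at [u = w p], [v = (1 - w) q]
    with [p = (PA + w QA)^-1 x], [q = (PB + (1 - w) QB)^-1 x] gives
    [H_SCI w <= M_F_star M].  Conversely the rank-one cross covariances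
    [M = c (PA p) (PB q)^T] show that the gap is at most a multiple of
    [s(x)^2 / |x|^2], where [s(x) = p^T PA p - q^T PB q] is the derivative in [w]
    of [x^T H_SCI(w) x].  So [g] touches [H_SCI w] exactly where [s] vanishes (or
    has the sign of the missing side when [w] is an endpoint).  If this happens
    nowhere, [s] is definite, and moving [w] improves the bound in all directions
    at once.  If it happens at [x0], any [D >= 0] below the gap is zero. *)

Require Import Defs.
From HB Require Import structures.
From mathcomp Require Import all_boot all_order all_algebra.
From mathcomp Require Import all_classical all_reals.
From mathcomp Require Import ring lra.
Import Order.TTheory GRing.Theory Num.Theory.
Local Open Scope ring_scope.
Local Open Scope classical_set_scope.

(** * Bilinear forms of matrices *)

Definition bf {R : realType} {n : nat} (A : 'M[R]_n) (x y : 'cV[R]_n) : R :=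
  (x^T *m A *m y) 0 0.

Section BilinearForms.
Context {R : realType} {n : nat}.
Implicit Types (A B M : 'M[R]_n) (x y z u v : 'cV[R]_n) (a : R).

Lemma qfE A x : qf A x = bf A x x.
Proof. by []. Qed.

Lemma bfDl A x y z : bf A (x + y) z = bf A x z + bf A y z.
Proof. by rewrite /bf linearD /= !mulmxDl mxE. Qed.

Lemma bfDr A x y z : bf A x (y + z) = bf A x y + bf A x z.
Proof. by rewrite /bf mulmxDr mxE. Qed.

Lemma bfZl A a x y : bf A (a *: x) y = a * bf A x y.
Proof. by rewrite /bf linearZ /= -!scalemxAl mxE. Qed.

Lemma bfZr A a x y : bf A x (a *: y) = a * bf A x y.
Proof. by rewrite /bf -scalemxAr mxE. Qed.

Lemma bfNl A x y : bf A (- x) y = - bf A x y.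
Proof. by rewrite -scaleN1r bfZl mulN1r. Qed.

Lemma bfNr A x y : bf A x (- y) = - bf A x y.
Proof. by rewrite -scaleN1r bfZr mulN1r. Qed.

Lemma bf0l A x : bf A 0 x = 0.
Proof. by rewrite /bf trmx0 !mul0mx mxE. Qed.

Lemma bf_addmx A B x y : bf (A + B) x y = bf A x y + bf B x y.
Proof. by rewrite /bf mulmxDr mulmxDl mxE. Qed.

Lemma bf_scalemx a A x y : bf (a *: A) x y = a * bf A x y.
Proof. by rewrite /bf -scalemxAr -scalemxAl mxE. Qed.

Lemma bf_oppmx A x y : bf (- A) x y = - bf A x y.
Proof. by rewrite -scaleN1r bf_scalemx mulN1r. Qed.

Lemma bf_trmx A x y : bf A^T x y = bf A y x.
Proof.
by rewrite /bf -[in RHS](trmxK (y^T *m A *m x)) [RHS]mxE !trmx_mul trmxK mulmxA.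
Qed.

Lemma bf_sym A x y : A^T = A -> bf A x y = bf A y x.
Proof. by move=> hA; rewrite -bf_trmx hA. Qed.

Lemma bf_mulmx A B x y : bf (A *m B) x y = bf A x (B *m y).
Proof. by rewrite /bf !mulmxA. Qed.

Lemma bf_congr A B x y : bf (B^T *m A *m B) x y = bf A (B *m x) (B *m y).
Proof. by rewrite /bf trmx_mul !mulmxA. Qed.

Lemma bf1C x y : bf 1%:M x y = bf 1%:M y x.
Proof. by apply: bf_sym; rewrite trmx1. Qed.

Lemma bf_as_dot A x y : bf A x y = bf 1%:M x (A *m y).
Proof. by rewrite -bf_mulmx mul1mx. Qed.

Lemma bf_outer u v x y : bf (u *m v^T) x y = bf 1%:M x u * bf 1%:M v y.
Proof.
by rewrite /bf !mulmx1 !mulmxA -[x^T *m u *m v^T *m y]mulmxA mxE big_ord1.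
Qed.

Lemma bf_delta A i j : bf A (delta_mx i 0) (delta_mx j 0) = A i j.
Proof. by rewrite /bf trmx_delta -rowE -colE !mxE. Qed.

Definition bfvE := (bfDl, bfDr, bfZl, bfZr, bfNl, bfNr).
Definition bfE := (bfvE, bf_addmx, bf_scalemx, bf_oppmx).

Lemma qf_block A B M u v :
  qf (block_mx A M M^T B) (col_mx u v) = qf A u + 2 * bf M u v + qf B v.
Proof.
rewrite {1}/qf tr_col_mx mul_row_block mul_row_col !mulmxDl.
rewrite mxE [X in X + _]mxE [X in _ + X]mxE.
rewrite -[(v^T *m M^T *m u) 0 0]/(bf M^T v u) bf_trmx.
by rewrite -[(u^T *m M *m v) 0 0]/(bf M u v) /qf; ring.
Qed.

Lemma psd_blockP A B M :
  psd (block_mx A M M^T B) <->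
  forall u v, 0 <= qf A u + 2 * bf M u v + qf B v.
Proof.
split=> [h u v|h x]; first by rewrite -qf_block.
by rewrite -[x]vsubmxK qf_block.
Qed.

Lemma sym_mx_eq0 A : A^T = A -> (forall x, qf A x = 0) -> A = 0.
Proof.
move=> hA h; apply/matrixP => i j; rewrite mxE -bf_delta.
set x := delta_mx i 0; set y := delta_mx j 0.
move: (h (x + y)) (h x) (h y); rewrite !qfE !bfE (bf_sym _ y x hA).
by lra.
Qed.

(** Along [t *: x + y] the form is affine in [t], and a nonnegative affine function has slope
    zero. *)
Lemma psd_isotropic A x y :
  A^T = A -> (forall z, 0 <= qf A z) -> qf A x = 0 -> bf A x y = 0.
Proof.
move=> hA pA x0; set b := bf A x y.
have h t : 0 <= 2 * t * b + qf A y.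
  move: (pA (t *: x + y)); rewrite qfE !bfE (bf_sym _ y x hA) -!qfE x0 -/b.
  by congr (0 <= _); ring.
apply/eqP; apply/negPn/negP => b0.
(* At this [t] the affine function takes the value -1. *)
move: (h (- (qf A y + 1) / (2 * b))).
rewrite (_ : 2 * _ * b = - (qf A y + 1)); first by lra.
by field.
Qed.

Lemma psd_cauchy_schwarz A x y :
  A^T = A -> (forall z, 0 <= qf A z) -> bf A x y ^+ 2 <= qf A x * qf A y.
Proof.
move=> hA pA; have [x0|x0] := eqVneq (qf A x) 0.
  by rewrite psd_isotropic // x0 mul0r expr0n.
have x_gt0 : 0 < qf A x by rewrite lt_neqAle eq_sym x0 pA.
move: (pA (bf A x y *: x - qf A x *: y)); rewrite qfE !bfE (bf_sym _ y x hA) -!qfE.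
rewrite (_ : _ + _ = qf A x * (qf A x * qf A y - bf A x y ^+ 2)); last by ring.
by rewrite pmulr_rge0 // subr_ge0.
Qed.

(** * Positive definite matrices and their inverses *)

Section PositiveDefinite.
Variable A : 'M[R]_n.
Hypothesis hA : sym_pd A.

Lemma pd_sym : A^T = A. Proof. by case: hA. Qed.

Lemma pd_gt0 x : x != 0 -> 0 < qf A x. Proof. by case: hA => _; apply. Qed.

Lemma pd_ge0 x : 0 <= qf A x.
Proof. by have [->|/pd_gt0/ltW//] := eqVneq x 0; rewrite qfE bf0l. Qed.

Lemma pd_unit : A \in unitmx.
Proof.
rewrite -row_free_unit -kermx_eq0; apply/negPn/negP => /rowV0Pn [v vk v0].
have : 0 < qf A v^T.
  by apply: pd_gt0; apply: contra v0 => /eqP v0; rewrite -[v]trmxK v0 trmx0.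
by rewrite /qf trmxK; move/sub_kermxP: vk => ->; rewrite mul0mx mxE ltxx.
Qed.

Lemma pd_inv_sym : (invmx A)^T = invmx A.
Proof. by rewrite trmx_inv pd_sym. Qed.

Lemma pd_mulKVmx x : A *m (invmx A *m x) = x.
Proof. by rewrite mulKVmx // pd_unit. Qed.

Lemma pd_inv_qf x : qf (invmx A) x = qf A (invmx A *m x).
Proof.
rewrite !qfE -bf_congr pd_inv_sym -mulmxA; congr bf.
by rewrite mulmxV ?pd_unit // mulmx1.
Qed.

Lemma pd_inv : sym_pd (invmx A).
Proof.
split; first exact: pd_inv_sym.
move=> x x0; rewrite pd_inv_qf; apply: pd_gt0.
by apply: contra x0 => /eqP h; rewrite -[x]pd_mulKVmx h mulmx0.
Qed.

(** The difference of the two sides is [qf A (z - invmx A *m x)]; so the form of the inverse is a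
    maximum over [z], attained as in [pd_inv_eq]. *)
Lemma pd_inv_ge x z : 2 * bf 1%:M z x - qf A z <= qf (invmx A) x.
Proof.
move: (pd_ge0 (z - invmx A *m x)); rewrite [in X in X -> _]qfE !bfE.
rewrite (bf_sym _ (invmx A *m x) z pd_sym) (bf_as_dot A z (invmx A *m x)) pd_mulKVmx.
by rewrite -!qfE -pd_inv_qf; lra.
Qed.

Lemma pd_inv_eq x : qf (invmx A) x =
  2 * bf 1%:M (invmx A *m x) x - qf A (invmx A *m x).
Proof.
by rewrite -pd_inv_qf bf1C -bf_as_dot -qfE; ring.
Qed.

(** The coordinate is the [A]-inner product of [invmx A *m delta_mx i 0] with [x], so Cauchy-Schwarz
    applies. *)
Lemma pd_coord_le x i :
  x i 0 ^+ 2 <= qf (invmx A) (delta_mx i 0) * qf A x.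
Proof.
have e : x i 0 = bf A (invmx A *m delta_mx i 0) x.
  rewrite (bf_sym _ _ x pd_sym) bf_as_dot pd_mulKVmx bf1C /bf mulmx1.
  by rewrite trmx_delta -rowE mxE.
rewrite e pd_inv_qf; apply: psd_cauchy_schwarz; [exact: pd_sym | exact: pd_ge0].
Qed.

(** Replaces compactness of the unit sphere: [pd_coord_le] bounds each product of coordinates by an
    explicit multiple of [qf A x]. *)
Lemma pd_dominates M : exists2 C, 0 < C & forall x, qf M x <= C * qf A x.
Proof.
pose G i := qf (invmx A) (delta_mx i 0 : 'cV_n).
have G0 i : 0 <= G i by rewrite /G pd_inv_qf pd_ge0.
pose C := \sum_i \sum_j `|M i j| * (G i + G j).
have C0 : 0 <= C.
  by apply: sumr_ge0 => i _; apply: sumr_ge0 => j _; rewrite mulr_ge0 ?addr_ge0.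
exists (C + 1) => [|x]; first by lra.
apply: (@le_trans _ _ (C * qf A x)); last by rewrite ler_wpM2r ?pd_ge0 //; lra.
rewrite /C mulr_suml /qf mxE.
rewrite (eq_bigr (fun j => \sum_i x i 0 * M i j * x j 0)); last first.
  by move=> j _; rewrite mxE mulr_suml; apply: eq_bigr => i _; rewrite mxE.
rewrite exchange_big /=; apply: ler_sum => i _.
rewrite mulr_suml; apply: ler_sum => j _.
have hi := pd_coord_le x i; have hj := pd_coord_le x j.
rewrite -/(G i) in hi; rewrite -/(G j) in hj.
apply: (le_trans (ler_norm _)); rewrite mulrAC normrM mulrC -mulrA.
apply: ler_wpM2l => //; rewrite normrM.
rewrite -real_normK ?num_real // in hi; rewrite -real_normK ?num_real // in hj.
have := sqr_ge0 (`|x i 0| - `|x j 0|).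
have := mulr_ge0 (normr_ge0 (x i 0)) (normr_ge0 (x j 0)).
by rewrite -/(qf A x); lra.
Qed.

End PositiveDefinite.
End BilinearForms.

(** * Sums of positive definite forms and elementary estimates *)

Lemma bf_mul3 {R : realType} {n : nat} (A K L : 'M[R]_n) (x y : 'cV[R]_n) :
  bf (K *m A *m L^T) x y = bf A (K^T *m x) (L^T *m y).
Proof. by rewrite /bf trmx_mul trmxK !mulmxA. Qed.

Lemma pd_addZ {R : realType} {n : nat} (A B : 'M[R]_n) (a : R) :
  sym_pd A -> sym_pd B -> 0 <= a -> sym_pd (A + a *: B).
Proof.
move=> hA hB a0; split=> [|x x0]; first by rewrite linearD linearZ /= !pd_sym.
rewrite qfE !bfE -!qfE; have := pd_gt0 _ hA _ x0.
by have := mulr_ge0 a0 (pd_ge0 _ hB x); lra.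
Qed.

Lemma pd_add {R : realType} {n : nat} (A B : 'M[R]_n) :
  sym_pd A -> sym_pd B -> sym_pd (A + B).
Proof. by move=> hA hB; rewrite -[B]scale1r; apply: pd_addZ. Qed.

(** Since [k B] dominates [A], [k] times the expression is at least [qf A ((k * t) *: p + a)]. This
    serves to absorb a term linear in a deviation [a]. *)
Lemma psd_young {R : realType} {n : nat} (A B : 'M[R]_n) (k t : R) (p a : 'cV[R]_n) :
  A^T = A -> (forall x, 0 <= qf A x) -> 0 < k ->
  (forall x, qf A x <= k * qf B x) ->
  0 <= k * t ^+ 2 * qf A p + 2 * t * bf A a p + qf B a.
Proof.
move=> sA pA k0 AB; have h := AB a.
have := pA ((k * t) *: p + a); rewrite qfE !bfE (bf_sym A p a sA) -!qfE => h2.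
rewrite -(pmulr_rge0 _ k0).
by apply: (le_trans h2); lra.
Qed.

Lemma small_step {R : realFieldType} (s N b : R) : 0 < s -> 0 <= N -> 0 < b ->
  exists2 e, 0 < e <= b & e * N < s.
Proof.
move=> s0 N0 b0; have N1 : 0 < N + 1 by lra.
exists (Num.min b (s / (N + 1))).
  by rewrite lt_min ge_min lexx b0 divr_gt0.
apply: (@le_lt_trans _ _ (s / (N + 1) * N)).
  by rewrite ler_wpM2r // ge_min lexx orbT.
by rewrite mulrAC ltr_pdivrMr //; lra.
Qed.

Lemma cV_neq0 (R : realType) (n : nat) : (0 < n)%N -> exists x : 'cV[R]_n, x != 0.
Proof.
move=> n0; exists (delta_mx (Ordinal n0) 0); apply/eqP => /matrixP.
by move=> /(_ (Ordinal n0) 0) /eqP; rewrite !mxE !eqxx oner_eq0.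
Qed.

Lemma quadratic_le0 {R : realFieldType} (a b c : R) :
  a < 0 -> exists t, t ^+ 2 * a + 2 * t * b + c <= 0.
Proof.
move=> a0; have na0 : 0 < - a by lra.
(* With this [m], [t] is at least 1 and [t * - a] at least [m], so the leading term outweighs the
   two others. *)
pose m := `|c| + 2 * `|b|; have m0 : 0 <= m by rewrite /m addr_ge0 ?mulr_ge0.
pose t := m / - a + 1; have t1 : 1 <= t by rewrite lerDr divr_ge0 // ltW.
have ta : t * - a = m - a by rewrite /t; field; rewrite lt_eqF.
exists t; have t0 : 0 <= t by lra.
have h1 : m * t <= t ^+ 2 * - a by rewrite expr2 -mulrA ta mulrC ler_wpM2l //; lra.
have h2 := ler_wpM2l (normr_ge0 c) t1.
have h3 := ler_wpM2l t0 (ler_norm b); have h4 := ler_norm c.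
by rewrite /m in h1; lra.
Qed.

(** The quadratic [qf A (x + t *: y)] in [t] has leading and constant coefficients of opposite
    signs, hence a real root. *)
Lemma indefinite_zero {R : realType} {n : nat} (A : 'M[R]_n) (x y : 'cV[R]_n) :
  A^T = A -> qf A x < 0 -> 0 < qf A y ->
  exists2 z, z != 0 & qf A z = 0.
Proof.
move=> sA x0 y0; pose b := bf A x y; pose s := Num.sqrt (b ^+ 2 - qf A x * qf A y).
have yN : qf A y != 0 by rewrite gt_eqF.
have s2 : s ^+ 2 = b ^+ 2 - qf A x * qf A y.
  by rewrite sqr_sqrtr // addr_ge0 ?sqr_ge0 // oppr_ge0 mulr_le0_ge0 ?ltW.
pose t := (s - b) / qf A y; exists (x + t *: y).
  (* If the vector were zero, [x] would be a multiple of [y] and [qf A x] nonnegative. *)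
  apply/eqP => /(canRL (addrK _)); rewrite sub0r => xE; move: x0.
  by rewrite xE qfE !bfE -qfE ltNge; have := mulr_ge0 (sqr_ge0 t) (ltW y0); lra.
rewrite qfE !bfE (bf_sym A y x sA) -!qfE -/b.
transitivity ((s ^+ 2 - b ^+ 2 + qf A x * qf A y) / qf A y); last first.
  by rewrite s2 (_ : _ + _ = 0) ?mul0r //; ring.
by rewrite /t; field.
Qed.

(** * Optimal fusion as a least-squares problem *)

Section SplitFusion.
Context {R : realType} {n : nat}.
Variables PA PB QA QB : 'M[R]_n.
Hypotheses (hPA : sym_pd PA) (hPB : sym_pd PB).
Hypotheses (hQA : sym_pd QA) (hQB : sym_pd QB).

Let trP := (pd_sym _ hPA, pd_sym _ hPB, pd_sym _ hQA, pd_sym _ hQB).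

(** The form of the joint covariance with diagonal blocks [PA + QA], [PB + QB] and cross block
    [M]. *)
Definition joint_qf (M : 'M[R]_n) (u v : 'cV[R]_n) : R :=
  qf (PA + QA) u + 2 * bf M u v + qf (PB + QB) v.

Section FixedCross.
Variable M : 'M[R]_n.
Hypothesis hM : A_Split PA PB M.

Lemma joint_qf_ge u v : qf QA u + qf QB v <= joint_qf M u v.
Proof.
move: ((psd_blockP PA PB M).1 hM u v); rewrite /joint_qf !qfE !bf_addmx.
by lra.
Qed.

Lemma joint_qf_gt0 u v : (u != 0) || (v != 0) -> 0 < joint_qf M u v.
Proof.
have := joint_qf_ge u v; have := pd_ge0 _ hQA u; have := pd_ge0 _ hQB v.
by move=> qv qu J /orP [/(pd_gt0 _ hQA)|/(pd_gt0 _ hQB)]; lra.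
Qed.

Local Notation Rm := (R_mat PA PB QA QB M).
Local Notation K := (KA_star PA PB QA QB M).
Local Notation CF := (C_F_star PA PB QA QB M).

Lemma R_mat_pd : sym_pd Rm.
Proof.
split=> [|x x0].
  by rewrite /R_mat !linearB !linearD /= trmxK !trP addrAC.
have -> : qf Rm x = joint_qf M x (- x).
  by rewrite /joint_qf /R_mat !qfE !bfE bf_trmx; ring.
by apply: joint_qf_gt0; rewrite x0.
Qed.

(** The normal equation for minimizing [joint_qf M u (z - u)] over [u]. *)
Lemma KA_star_tr (z : 'cV[R]_n) : Rm *m (K^T *m z) = ((PB + QB) - M) *m z.
Proof.
rewrite /KA_star trmx_mul (pd_inv_sym _ R_mat_pd) -mulmxA.
by rewrite (pd_mulKVmx _ R_mat_pd) linearB linearD /= trmxK !trP.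
Qed.

Lemma qf_C_F_star z : qf CF z = joint_qf M (K^T *m z) (z - K^T *m z).
Proof.
rewrite /C_F_star /C_F qfE !bf_addmx !bf_mul3 bf_trmx.
by rewrite [(1%:M - K)^T]linearB /= trmx1 mulmxBl mul1mx /joint_qf !qfE !bf_addmx; ring.
Qed.

(** By the normal equation the cross term vanishes, and the excess over the minimizer [u0] is
    [qf Rm (u - u0)]. *)
Lemma C_F_star_min u z : qf CF z <= joint_qf M u (z - u).
Proof.
rewrite qf_C_F_star; set u0 := K^T *m z.
have -> : joint_qf M u (z - u) = joint_qf M u0 (z - u0) + qf Rm (u - u0).
  have e : bf Rm (u - u0) u0 = bf ((PB + QB) - M) (u - u0) z.
    by rewrite bf_as_dot KA_star_tr -bf_as_dot.
  rewrite /joint_qf; move: e; rewrite /R_mat !qfE !bfE !bf_trmx.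
  rewrite (bf_sym PA u u0) ?pd_sym // (bf_sym QA u u0) ?pd_sym //.
  rewrite (bf_sym PB u u0) ?pd_sym // (bf_sym QB u u0) ?pd_sym //.
  rewrite (bf_sym PB u z) ?pd_sym // (bf_sym QB u z) ?pd_sym //.
  rewrite (bf_sym PB u0 z) ?pd_sym // (bf_sym QB u0 z) ?pd_sym //.
  by lra.
by rewrite lerDl; apply: pd_ge0; exact: R_mat_pd.
Qed.

Lemma C_F_star_pd : sym_pd CF.
Proof.
split=> [|z z0].
  rewrite /C_F_star /=; move: (K) (1%:M - K) => K1 K2.
  have sA := pd_sym _ (pd_add _ _ hPA hQA); have sB := pd_sym _ (pd_add _ _ hPB hQB).
  rewrite /C_F; move: sA sB; move: (PA + QA) (PB + QB) => CA CB sA sB.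
  by rewrite !linearD /= !trmx_mul !trmxK sA sB !mulmxA (addrAC (K1 *m _ *m _)).
rewrite qf_C_F_star; apply: joint_qf_gt0.
by have [->|//] := eqVneq (K^T *m z) 0; rewrite subr0 z0.
Qed.

(** Weak duality: [pd_inv_ge] at [u + v], then [C_F_star_min] for its splitting into [u] and [v].
    The next lemma gives attainment. *)
Lemma M_F_star_ge x u v :
  2 * bf 1%:M (u + v) x - joint_qf M u v <= qf (M_F_star PA PB QA QB M) x.
Proof.
have := pd_inv_ge _ C_F_star_pd x (u + v).
have := C_F_star_min u (u + v); rewrite [u + v]addrC addrK /M_F_star.
by lra.
Qed.

Lemma M_F_star_eq x : exists u v,
  qf (M_F_star PA PB QA QB M) x = 2 * bf 1%:M (u + v) x - joint_qf M u v.
Proof.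
pose z := invmx CF *m x; exists (K^T *m z), (z - K^T *m z).
rewrite -qf_C_F_star [_ + (z - _)]addrC subrK /M_F_star -pd_inv_eq //.
exact: C_F_star_pd.
Qed.

Lemma M_F_star_pd : sym_pd (M_F_star PA PB QA QB M).
Proof. exact: pd_inv C_F_star_pd. Qed.

End FixedCross.

(** * The SCI bound at a fixed weight *)

Section FixedWeight.
Variable w : R.
Hypothesis hw : 0 <= w <= 1.

Let w_ge0 : 0 <= w. Proof. by case/andP: hw. Qed.
Let w_le1 : 0 <= 1 - w. Proof. by case/andP: hw => _; rewrite subr_ge0. Qed.

Definition XA : 'M[R]_n := invmx (PA + w *: QA).
Definition XB : 'M[R]_n := invmx (PB + (1 - w) *: QB).

Let hFA : sym_pd (PA + w *: QA). Proof. exact: pd_addZ. Qed.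
Let hFB : sym_pd (PB + (1 - w) *: QB). Proof. exact: pd_addZ. Qed.

(** Since [x] is [PA + w *: QA] applied to [XA *m x], pairings with [x] turn into values of the
    forms [PA] and [QA]. *)
Lemma dotXA z x : bf 1%:M z x = bf PA z (XA *m x) + w * bf QA z (XA *m x).
Proof.
by rewrite -[x in LHS](pd_mulKVmx _ hFA) -bf_as_dot !bfE.
Qed.

Lemma dotXB z x : bf 1%:M z x = bf PB z (XB *m x) + (1 - w) * bf QB z (XB *m x).
Proof.
by rewrite -[x in LHS](pd_mulKVmx _ hFB) -bf_as_dot !bfE.
Qed.

Lemma qf_H_SCI x : qf (H_SCI PA PB QA QB w) x =
  w * (qf PA (XA *m x) + w * qf QA (XA *m x)) +
  (1 - w) * (qf PB (XB *m x) + (1 - w) * qf QB (XB *m x)).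
Proof.
rewrite /H_SCI qfE !bfE -!qfE (pd_inv_qf _ hFA) (pd_inv_qf _ hFB) -/XA -/XB.
by rewrite !qfE !bf_addmx !bf_scalemx.
Qed.

Lemma XA_neq0 (x : 'cV[R]_n) : x != 0 -> XA *m x != 0.
Proof.
by apply: contra => /eqP h; rewrite -[x](pd_mulKVmx _ hFA) -/XA h mulmx0.
Qed.

Lemma XB_neq0 (x : 'cV[R]_n) : x != 0 -> XB *m x != 0.
Proof.
by apply: contra => /eqP h; rewrite -[x](pd_mulKVmx _ hFB) -/XB h mulmx0.
Qed.

Lemma H_SCI_pd : sym_pd (H_SCI PA PB QA QB w).
Proof.
split=> [|x x0].
  by rewrite /H_SCI linearD !linearZ /= (pd_inv_sym _ hFA) (pd_inv_sym _ hFB).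
rewrite qf_H_SCI.
have pa := pd_gt0 _ hPA _ (XA_neq0 _ x0); have pb := pd_gt0 _ hPB _ (XB_neq0 _ x0).
have qa := pd_ge0 _ hQA (XA *m x); have qb := pd_ge0 _ hQB (XB *m x).
have := mulr_ge0 w_ge0 (mulr_ge0 w_ge0 qa); have := mulr_ge0 w_le1 (mulr_ge0 w_le1 qb).
(* At an endpoint one summand vanishes, so positivity is taken from the summand whose weight is at
   least one half. *)
have [w2|w2] := lerP (1 / 2) w.
  have : 0 < w * qf PA (XA *m x) by apply: mulr_gt0 => //; lra.
  by have := mulr_ge0 w_le1 (ltW pb); lra.
have : 0 < (1 - w) * qf PB (XB *m x) by apply: mulr_gt0 => //; lra.
by have := mulr_ge0 w_ge0 (ltW pa); lra.
Qed.

Lemma M_F_star_ge_H_SCI M x : A_Split PA PB M ->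
  qf (H_SCI PA PB QA QB w) x <= qf (M_F_star PA PB QA QB M) x.
Proof.
move=> hM; apply: le_trans (M_F_star_ge _ hM x (w *: (XA *m x)) ((1 - w) *: (XB *m x))).
set p := XA *m x; set q := XB *m x.
(* The dual value at the trial pair exceeds [H_SCI] by exactly [w * (1 - w)] times this nonnegative
   quantity. *)
have := (psd_blockP PA PB M).1 hM p (- q).
rewrite bfDl !bfZl (dotXA p) (dotXB q) -/p -/q qf_H_SCI -/p -/q /joint_qf !qfE !bfE.
by have := mulr_ge0 w_ge0 w_le1; nra.
Qed.

(* The derivative of [H_SCI] at [w]. *)
Definition slope_mx : 'M[R]_n := XA^T *m PA *m XA - XB^T *m PB *m XB.
Definition curv_mx : 'M[R]_n := XA^T *m QA *m XA + XB^T *m QB *m XB.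

Lemma slope_mxE x : qf slope_mx x = qf PA (XA *m x) - qf PB (XB *m x).
Proof. by rewrite qfE !bfE !bf_congr. Qed.

Lemma slope_mx_sym : slope_mx^T = slope_mx.
Proof. by rewrite linearB /= !trmx_mul !trmxK !trP !mulmxA. Qed.

Lemma curv_mxE x : qf curv_mx x = qf QA (XA *m x) + qf QB (XB *m x).
Proof. by rewrite qfE !bfE !bf_congr. Qed.

Lemma curv_mx_ge0 x : 0 <= qf curv_mx x.
Proof. by rewrite curv_mxE addr_ge0 ?pd_ge0. Qed.

(** The vectors [XA *m x] and [XB *m x] of [w] are tested in [pd_inv_ge] at [w']; the resulting
    polynomial in [w'] is exactly the left side. *)
Lemma H_SCI_taylor w' x : 0 <= w' <= 1 ->
  qf (H_SCI PA PB QA QB w) x + (w' - w) * qf slope_mx x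
    - (w' - w) ^+ 2 * qf curv_mx x <= qf (H_SCI PA PB QA QB w') x.
Proof.
case/andP=> w'0 w'1; have w'2 : 0 <= 1 - w' by rewrite subr_ge0.
have ia := pd_inv_ge _ (pd_addZ _ _ _ hPA hQA w'0) x (XA *m x).
have ib := pd_inv_ge _ (pd_addZ _ _ _ hPB hQB w'2) x (XB *m x).
move: (ler_wpM2l w'0 ia) (ler_wpM2l w'2 ib) => {ia ib}.
rewrite dotXA dotXB slope_mxE curv_mxE qf_H_SCI /H_SCI !qfE !bfE.
by lra.
Qed.

(** The dual objective of a rank-one [M] is expanded around [(w p, (1 - w) q)]. The value there
    gives the [w * (1 - w)] term; the linear terms, with coefficients proportional to [c * b - 1]
    and [c * a - 1], are absorbed by [QA] and [QB] at cost [k], which does not depend on [y]. *)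
Lemma M_F_star_le_H_SCI : exists2 k, 0 <= k & forall y c,
  let a := qf PA (XA *m y) in let b := qf PB (XB *m y) in
  0 <= c -> c ^+ 2 * (a * b) <= 1 ->
  exists2 M, A_Split PA PB M &
    qf (M_F_star PA PB QA QB M) y <= qf (H_SCI PA PB QA QB w) y
      + w * (1 - w) * (a + b - 2 * c * (a * b))
      + k * ((1 - w) ^+ 2 * (c * b - 1) ^+ 2 * a + w ^+ 2 * (c * a - 1) ^+ 2 * b).
Proof.
have [ka ka0 kaP] := pd_dominates _ hQA PA.
have [kb kb0 kbP] := pd_dominates _ hQB PB.
have k0 : 0 < ka + kb by apply: addr_gt0.
exists (ka + kb) => [|y c]; first exact: ltW.
set p := XA *m y; set q := XB *m y => a b c0 cab.
have aP x : qf PA x <= (ka + kb) * qf QA x.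
  by apply: le_trans (kaP x) _; rewrite ler_wpM2r ?pd_ge0 // lerDl ltW.
have bP x : qf PB x <= (ka + kb) * qf QB x.
  by apply: le_trans (kbP x) _; rewrite ler_wpM2r ?pd_ge0 // lerDr ltW.
(* For [c = 1 / sqrt (a b)] and [a = b] this [M] makes [(w p, (1 - w) q)] the
   maximizer of the dual problem. *)
pose M := c *: ((PA *m p) *m (PB *m q)^T).
have ME u v : bf M u v = c * (bf PA u p * bf PB v q).
  by rewrite bf_scalemx bf_outer -!bf_as_dot [bf _ _ v]bf1C -bf_as_dot.
have psdM u v : 0 <= qf PA u + 2 * bf M u v + qf PB v.
  have := psd_cauchy_schwarz PA u p (pd_sym _ hPA) (pd_ge0 _ hPA).
  have := psd_cauchy_schwarz PB v q (pd_sym _ hPB) (pd_ge0 _ hPB).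
  have U0 := pd_ge0 _ hPA u; have V0 := pd_ge0 _ hPB v.
  rewrite ME -/a -/b; set X := bf PA u p; set Y := bf PB v q => hY hX.
  have h : (2 * (c * (X * Y))) ^+ 2 <= (qf PA u + qf PB v) ^+ 2.
    apply: (@le_trans _ _ (4 * (qf PA u * qf PB v))); last first.
      by have := sqr_ge0 (qf PA u - qf PB v); lra.
    have hXY := ler_pM (sqr_ge0 X) (sqr_ge0 Y) hX hY.
    have := ler_wpM2l (sqr_ge0 c) hXY.
    have := ler_wpM2r (mulr_ge0 U0 V0) cab; lra.
  (* A negative sum would make the square of the cross term exceed that of [qf PA u + qf PB v],
     against [h]. *)
  rewrite leNgt; apply/negP => h0; have W0 := addr_ge0 U0 V0.
  have : 0 < (- (2 * (c * (X * Y))) - (qf PA u + qf PB v)) *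
             (- (2 * (c * (X * Y))) + (qf PA u + qf PB v)) by apply: mulr_gt0; lra.
  by lra.
have hM : A_Split PA PB M by apply/psd_blockP.
clearbody M.
exists M => //; have [u [v ->]] := M_F_star_eq _ hM y.
pose u1 := u - w *: p; pose v1 := v - (1 - w) *: q.
have -> : u = w *: p + u1 by rewrite addrC subrK.
have -> : v = (1 - w) *: q + v1 by rewrite addrC subrK.
clearbody u1 v1.
have ya := psd_young _ QA _ ((1 - w) * (c * b - 1)) p u1
  (pd_sym _ hPA) (pd_ge0 _ hPA) k0 aP.
have yb := psd_young _ QB _ (w * (c * a - 1)) q v1
  (pd_sym _ hPB) (pd_ge0 _ hPB) k0 bP.
move: ya yb (psdM u1 v1); rewrite bfDl (dotXA _ y) (dotXB _ y) -/p -/q /joint_qf.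
rewrite qf_H_SCI -/p -/q !qfE !bfE !ME.
rewrite (bf_sym PA p u1) ?trP // (bf_sym PB q v1) ?trP //.
rewrite (bf_sym QA p u1) ?trP // (bf_sym QB q v1) ?trP // -!qfE -/a -/b.
lra.
Qed.

(** The positive definite gauge that stands for the squared norm in the gap estimate. *)
Definition sum_mx : 'M[R]_n := XA^T *m PA *m XA + XB^T *m PB *m XB.

Lemma sum_mxE x : qf sum_mx x = qf PA (XA *m x) + qf PB (XB *m x).
Proof. by rewrite qfE !bfE !bf_congr. Qed.

Lemma sum_mx_pd : sym_pd sum_mx.
Proof.
split=> [|x x0]; first by rewrite linearD /= !trmx_mul !trmxK !trP !mulmxA.
rewrite sum_mxE; have := pd_gt0 _ hPA _ (XA_neq0 _ x0).
by have := pd_gt0 _ hPB _ (XB_neq0 _ x0); lra.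
Qed.

(** For the [c] chosen below, every error term of [M_F_star_le_H_SCI] is at most a constant times
    [(a - b) ^+ 2 / (a + b)]. *)
Lemma M_F_star_le_slope : exists2 k, 0 <= k & forall y,
  exists2 M, A_Split PA PB M &
    (qf (M_F_star PA PB QA QB M) y - qf (H_SCI PA PB QA QB w) y) * qf sum_mx y
      <= k * qf slope_mx y ^+ 2.
Proof.
have [k k0 kP] := M_F_star_le_H_SCI; exists (1 + k) => [|y]; first by lra.
have [->|y0] := eqVneq y 0.
  have [|M hM _] := kP 0 0 (lexx _); first by rewrite expr0n mul0r.
  by exists M => //; rewrite !qfE !bf0l; lra.
(* [c = 2 / (a + b)] approximates [1 / sqrt (a b)] to second order in [a - b] and
   is admissible by AM-GM. *)
have L0 := pd_gt0 _ sum_mx_pd _ y0; move: (L0); rewrite sum_mxE slope_mxE => ab0.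
have a0 := pd_ge0 _ hPA (XA *m y); have b0 := pd_ge0 _ hPB (XB *m y).
move: ab0 a0 b0 (kP y (2 / (qf PA (XA *m y) + qf PB (XB *m y)))).
set a := qf PA _; set b := qf PB _; cbv zeta => ab0 a0 b0 h.
have abN : a + b != 0 by rewrite gt_eqF.
case: h => [||M hM hm]; first by rewrite divr_ge0 // ltW.
  rewrite expr_div_n mulrAC ler_pdivrMr ?exprn_gt0 // mul1r.
  by have := sqr_ge0 (a - b); lra.
exists M => //.
move: hm; set m := qf (M_F_star _ _ _ _ _) y; set h := qf (H_SCI _ _ _ _ _) y => hm.
have D0 : 0 <= (a - b) ^+ 2 / (a + b) by rewrite divr_ge0 ?sqr_ge0 // ltW.
rewrite -ler_pdivlMr // -mulrA.
have e1 : a + b - 2 * (2 / (a + b)) * (a * b) = (a - b) ^+ 2 / (a + b) by field.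
have e2 : (2 / (a + b) * b - 1) ^+ 2 = (a - b) ^+ 2 / (a + b) / (a + b) by field.
have e3 : (2 / (a + b) * a - 1) ^+ 2 = (a - b) ^+ 2 / (a + b) / (a + b) by field.
move: hm; rewrite e1 e2 e3; set E := (a - b) ^+ 2 / (a + b) in D0 *.
have ww : w * (1 - w) <= 1 by have := sqr_ge0 (w - 1 / 2); lra.
have ha : (1 - w) ^+ 2 <= 1 by rewrite expr_le1 // lerBlDl lerDr.
have hb : w ^+ 2 <= 1 by rewrite expr_le1 //; case/andP: hw.
have : (1 - w) ^+ 2 * (E / (a + b)) * a + w ^+ 2 * (E / (a + b)) * b <= E.
  rewrite (_ : _ + _ = E * (((1 - w) ^+ 2 * a + w ^+ 2 * b) / (a + b))); last by field.
  rewrite ler_piMr // ler_pdivrMr // mul1r.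
  by apply: lerD; rewrite ler_piMl.
move=> /(ler_wpM2l k0); have := ler_wpM2r D0 ww; lra.
Qed.

(* First-order condition for [w] to maximize the concave function [qf (H_SCI _) y]
   on [0, 1]. *)
Definition contact (y : 'cV[R]_n) : Prop :=
  [\/ qf slope_mx y = 0, w = 0 /\ qf slope_mx y <= 0 | w = 1 /\ 0 <= qf slope_mx y].

Lemma contact_attained y : y != 0 -> contact y ->
  exists2 M, A_Split PA PB M &
    qf (M_F_star PA PB QA QB M) y <= qf (H_SCI PA PB QA QB w) y.
Proof.
move=> y0; have a0 := pd_gt0 _ hPA _ (XA_neq0 _ y0).
have b0 := pd_gt0 _ hPB _ (XB_neq0 _ y0).
have [k k0 kP] := M_F_star_le_H_SCI.
case=> [s0|[w0]|[w1]]; last 2 first.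
- rewrite slope_mxE subr_le0 => ab.
  (* At [w = 0] only the term in [(c * b - 1) ^+ 2] survives; [c = 1 / b] removes it and is
     admissible because [a <= b]. The case [w = 1] is symmetric. *)
  case: (kP y (qf PB (XB *m y))^-1) => [||M hM hm].
  + by rewrite invr_ge0 ltW.
  + move: a0 b0 ab; set a := qf PA _; set b := qf PB _ => a0 b0 ab.
    rewrite (_ : b^-1 ^+ 2 * (a * b) = a / b); last by field; rewrite gt_eqF.
    by rewrite ler_pdivrMr // mul1r.
  + exists M => //; apply: le_trans hm _.
    rewrite w0 mulVf ?gt_eqF // subrr !expr0n /=.
    lra.
- rewrite slope_mxE subr_ge0 => ab.
  case: (kP y (qf PA (XA *m y))^-1) => [||M hM hm].
  + by rewrite invr_ge0 ltW.
  + move: a0 b0 ab; set a := qf PA _; set b := qf PB _ => a0 b0 ab.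
    rewrite (_ : a^-1 ^+ 2 * (a * b) = b / a); last by field; rewrite gt_eqF.
    by rewrite ler_pdivrMr // mul1r.
  + exists M => //; apply: le_trans hm _.
    rewrite w1 mulVf ?gt_eqF // subrr !expr0n /=.
    lra.
have [k' k0' kP'] := M_F_star_le_slope; have [M hM] := kP' y.
rewrite s0 expr0n mulr0 pmulr_lle0 ?(pd_gt0 _ sum_mx_pd) // subr_le0 => hm.
by exists M.
Qed.

(** Makes the set under the infimum in [g_fun] nonempty, so that lower bounds pass to [g_fun]. *)
Lemma A_Split0 : A_Split PA PB 0.
Proof.
apply/psd_blockP => u v; have := pd_ge0 _ hPA u; have := pd_ge0 _ hPB v.
by rewrite /bf mulmx0 mul0mx mxE; lra.
Qed.

Lemma g_fun_ge_H_SCI x : qf (H_SCI PA PB QA QB w) x <= g_fun PA PB QA QB x.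
Proof.
apply: lb_le_inf.
  by exists (qf (M_F_star PA PB QA QB 0) x), 0 => //; exact: A_Split0.
by move=> _ [M hM <-]; exact: M_F_star_ge_H_SCI.
Qed.

Lemma g_fun_le M x : A_Split PA PB M ->
  g_fun PA PB QA QB x <= qf (M_F_star PA PB QA QB M) x.
Proof.
move=> hM; apply: ge_inf; last by exists M.
exists 0 => _ [M' hM' <-]; apply: pd_ge0; exact: M_F_star_pd.
Qed.

End FixedWeight.

(** * Varying the weight, and rigidity at a contact vector *)

(** As [g_fun] lies above [H_SCI] at every weight, equality at [w] makes [w] a maximizer; a small
    step along the slope would contradict [H_SCI_taylor]. *)
Lemma contact_of_g_fun_eq (w : R) (x : 'cV[R]_n) : 0 <= w <= 1 ->
  g_fun PA PB QA QB x = qf (H_SCI PA PB QA QB w) x -> contact w x.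
Proof.
move=> hw gE; have N0 := curv_mx_ge0 w x; case/andP: (hw) => w0 w1.
have h w' : 0 <= w' <= 1 ->
    (w' - w) * qf (slope_mx w) x <= (w' - w) ^+ 2 * qf (curv_mx w) x.
  move=> hw'; have := H_SCI_taylor _ hw w' x hw'.
  by have := g_fun_ge_H_SCI _ hw' x; rewrite gE; lra.
have [s0|s0|s0] := ltgtP (qf (slope_mx w) x) 0; last by constructor 1.
- have [w_0|wN0] := eqVneq w 0; first by constructor 2; split=> //; rewrite ltW.
  have w_gt0 : 0 < w by rewrite lt_neqAle eq_sym wN0.
  have sN : 0 < - qf (slope_mx w) x by lra.
  have [e /andP[e0 ew] he] := small_step _ _ _ sN N0 w_gt0.
  have := h (w - e); rewrite (_ : w - e - w = - e); last by ring.
  move=> /(_ ltac:(lra)); rewrite sqrrN mulNr expr2 -mulrA -mulrN ler_pM2l //; lra.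
- have [w_1|wN1] := eqVneq w 1; first by constructor 3; split=> //; rewrite ltW.
  have w_lt1 : 0 < 1 - w by rewrite subr_gt0 lt_neqAle wN1.
  have [e /andP[e0 ew] he] := small_step _ _ _ s0 N0 w_lt1.
  have := h (w + e); rewrite (_ : w + e - w = e); last by ring.
  move=> /(_ ltac:(lra)); rewrite expr2 -mulrA ler_pM2l //; lra.
Qed.

(** The sign [sg] is the direction in which [w] moves. One step length works for all [x] because the
    definite slope form dominates the curvature form. *)
Lemma H_SCI_improve (w sg : R) : 0 <= w <= 1 ->
  (sg = 1 /\ w < 1) \/ (sg = -1 /\ 0 < w) ->
  (forall x, x != 0 -> 0 < sg * qf (slope_mx w) x) ->
  exists2 w', 0 <= w' <= 1 &
    forall x, x != 0 -> qf (H_SCI PA PB QA QB w) x < qf (H_SCI PA PB QA QB w') x.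
Proof.
move=> hw hsg Spos; case/andP: (hw) => w0 w1.
have Spd : sym_pd (sg *: slope_mx w).
  split=> [|x x0]; first by rewrite linearZ /= slope_mx_sym.
  by rewrite qfE bf_scalemx Spos.
have [C C0 hC] := pd_dominates _ Spd (curv_mx w).
have [b b0 hb] : exists2 b, 0 < b & forall e, 0 < e <= b -> 0 <= w + sg * e <= 1.
  case: hsg => -[-> hw1]; first by exists (1 - w) => [|e /andP[]]; lra.
  by exists w => // e /andP[]; lra.
have [e he eC] := small_step _ _ _ (@ltr01 R) (ltW C0) b0.
exists (w + sg * e) => [|x x0]; first exact: hb.
apply: lt_le_trans (H_SCI_taylor _ hw _ x (hb _ he)).
rewrite (_ : w + sg * e - w = sg * e); last by ring.
have sg2 : sg ^+ 2 = 1 by case: hsg => -[-> _]; rewrite ?sqrrN expr1n.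
have Sx := Spos x x0; have := hC x; rewrite [qf (sg *: _) x]qfE bf_scalemx -qfE => Nx.
rewrite exprMn sg2 mul1r -addrA ltrDl subr_gt0.
case/andP: he => e0 _; rewrite (mulrC sg e) expr2 -!mulrA ltr_pM2l //.
apply: (@le_lt_trans _ _ (e * (C * (sg * qf (slope_mx w) x)))); first by rewrite ler_pM2l.
by rewrite mulrA gtr_pMl.
Qed.

(** Without contact the slope form has no nontrivial zero, so [indefinite_zero] forces a constant
    sign; the endpoint clauses of [contact] leave room to move [w] in that direction. *)
Lemma slope_mx_definite (w : R) : (0 < n)%N -> 0 <= w <= 1 ->
  (forall x, x != 0 -> ~ contact w x) ->
  exists2 sg, (sg = 1 /\ w < 1) \/ (sg = -1 /\ 0 < w) &
    forall x, x != 0 -> 0 < sg * qf (slope_mx w) x.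
Proof.
move=> n0 hw nc; case/andP: (hw) => w0 w1.
have sN0 x : x != 0 -> qf (slope_mx w) x != 0.
  by move=> x0; apply/eqP => s0; apply: (nc x x0); constructor 1.
have same x y : x != 0 -> 0 < qf (slope_mx w) y -> 0 < qf (slope_mx w) x.
  move=> x0 sy; rewrite ltNge; apply/negP => sx.
  have {}sx : qf (slope_mx w) x < 0 by rewrite lt_neqAle sN0.
  by have [z /sN0 /eqP] := indefinite_zero _ x y (slope_mx_sym w) sx sy.
have [x1 x1N0] := cV_neq0 R _ n0.
have [s1|s1|s1] := ltgtP (qf (slope_mx w) x1) 0; last by case/eqP: (sN0 _ x1N0).
- exists (-1).
    right; split=> //; rewrite lt_neqAle w0 andbT eq_sym; apply/eqP => w_0.
    by apply: (nc x1 x1N0); constructor 2; split=> //; rewrite ltW.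
  move=> x x0; rewrite mulN1r oppr_gt0 ltNge; apply/negP => sx.
  have {}sx : 0 < qf (slope_mx w) x by rewrite lt_neqAle eq_sym sN0.
  by have := same _ _ x1N0 sx; rewrite ltNge ltW.
- exists 1 => [|x x0]; last by rewrite mul1r; apply: same s1.
  left; split=> //; rewrite lt_neqAle w1 andbT; apply/eqP => w_1.
  by apply: (nc x1 x1N0); constructor 3; split=> //; rewrite ltW.
Qed.

(* If the gradient of the slope form at [x0] does not vanish, every line
   [a x0 + u] transverse to it meets the contact cone; if it vanishes, the gap
   between [M_F_star] and [H_SCI] near [x0] is of fourth order, while a nonzero
   positive semidefinite [D] would be of second order. *)
Lemma contact_gap_eq0 (w : R) (D : 'M[R]_n) (x0 : 'cV[R]_n) : 0 <= w <= 1 ->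
  D^T = D -> (forall z, 0 <= qf D z) ->
  (forall M z, A_Split PA PB M ->
    qf D z <= qf (M_F_star PA PB QA QB M) z - qf (H_SCI PA PB QA QB w) z) ->
  x0 != 0 -> contact w x0 -> D = 0.
Proof.
move=> hw sD D0 Dle x0N0 cx0.
have dc y : contact w y -> qf D y = 0.
  move=> cy; have [->|y0] := eqVneq y 0; first by rewrite qfE bf0l.
  have [M hM hm] := contact_attained _ hw _ y0 cy.
  by apply: le_anti; rewrite D0 andbT; apply: le_trans (Dle _ y hM) _; rewrite subr_le0.
have dx0 := dc _ cx0; have Dx0 v := psd_isotropic _ x0 v sD D0 dx0.
apply: sym_mx_eq0 => // v.
have [[u0 hu0]|S0] := pselect (exists u, bf (slope_mx w) x0 u != 0).
- have du u : bf (slope_mx w) x0 u != 0 -> qf D u = 0.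
    move=> hu.
    have [a ca] : exists a, contact w (a *: x0 + u).
      rewrite /contact.
      have sE a : qf (slope_mx w) (a *: x0 + u) = a ^+ 2 * qf (slope_mx w) x0
          + 2 * a * bf (slope_mx w) x0 u + qf (slope_mx w) u.
        by rewrite !qfE !bfvE (bf_sym _ u x0 (slope_mx_sym w)); ring.
      case: cx0 => [s0|[w0 s0]|[w1 s0]].
      + exists (- qf (slope_mx w) u / (2 * bf (slope_mx w) x0 u)).
        by constructor 1; rewrite sE s0; field.
      + move: s0; rewrite le_eqVlt => /orP[/eqP s0|s0].
          exists (- qf (slope_mx w) u / (2 * bf (slope_mx w) x0 u)).
          by constructor 1; rewrite sE s0; field.
        have [a ha] := quadratic_le0 _ (bf (slope_mx w) x0 u) (qf (slope_mx w) u) s0.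
        by exists a; constructor 2; rewrite sE.
      + move: s0; rewrite le_eqVlt => /orP[/eqP s0|s0].
          exists (- qf (slope_mx w) u / (2 * bf (slope_mx w) x0 u)).
          by constructor 1; rewrite sE -s0; field.
        rewrite -oppr_lt0 in s0.
        have [a ha] := quadratic_le0 _ (- bf (slope_mx w) x0 u) (- qf (slope_mx w) u) s0.
        by exists a; constructor 3; rewrite sE; split=> //; lra.
    by have := dc _ ca; rewrite qfE !bfvE (bf_sym D u x0) // !Dx0 -!qfE; lra.
  have [hv|/du//] := eqVneq (bf (slope_mx w) x0 v) 0.
  (* Here [u0 + v] is still transverse, so [D] vanishes at [u0] and at [u0 + v], hence at [v]. *)
  have := du (u0 + v); rewrite bfDr hv addr0 => /(_ hu0).
  have du0 := du _ hu0; have Du0 := psd_isotropic _ u0 v sD D0 du0.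
  by rewrite qfE !bfvE (bf_sym D v u0) // Du0 -!qfE du0; lra.
have {}S0 u : bf (slope_mx w) x0 u = 0.
  by apply/eqP/negPn/negP => h; apply: S0; exists u.
have [k k0 kP] := M_F_star_le_slope _ hw.
have dL y : qf D y * qf (sum_mx w) y <= k * qf (slope_mx w) y ^+ 2.
  have [M hM] := kP y; apply: le_trans.
  by rewrite ler_wpM2r ?Dle //; apply: pd_ge0; exact: sum_mx_pd.
have L0 := pd_gt0 _ (sum_mx_pd _ hw) _ x0N0.
have Lv := pd_ge0 _ (sum_mx_pd _ hw) v.
have h e : e ^+ 2 * qf D v * (qf (sum_mx w) x0 + 2 * e * bf (sum_mx w) x0 v
    + e ^+ 2 * qf (sum_mx w) v) <= k * (e ^+ 2 * qf (slope_mx w) v) ^+ 2.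
  have := dL (x0 + e *: v).
  rewrite !qfE !bfvE (bf_sym D v x0) // (bf_sym _ v x0 (slope_mx_sym w)).
  rewrite (bf_sym _ v x0 (pd_sym _ (sum_mx_pd _ hw))) !Dx0 !S0.
  by rewrite (_ : 0 + _ + _ = e ^+ 2 * bf D v v); last ring; lra.
apply: le_anti; rewrite D0 andbT leNgt; apply/negP => dv.
(* Chosen so that the fourth-order bound falls below the second-order term
   [qf D v * qf (sum_mx w) x0]. *)
have [e /andP[e0 e1] he] := small_step _ _ _ (mulr_gt0 dv L0)
  (mulr_ge0 k0 (sqr_ge0 (qf (slope_mx w) v))) ltr01.
have e2 : 0 < e ^+ 2 by rewrite exprn_gt0.
have : e ^+ 2 * (qf D v * (qf (sum_mx w) x0 + e ^+ 2 * qf (sum_mx w) v)) <=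
    e ^+ 2 * (e ^+ 2 * (k * qf (slope_mx w) v ^+ 2)).
  (* Averaging over both signs of [e] cancels the odd term. *)
  by have := h e; have := h (- e); lra.
rewrite ler_pM2l // => h2.
have h3 : e ^+ 2 * (k * qf (slope_mx w) v ^+ 2) <= e * (k * qf (slope_mx w) v ^+ 2).
  apply: ler_wpM2r; first by rewrite mulr_ge0 // sqr_ge0.
  by rewrite expr2 ler_piMl // ltW.
have := mulr_ge0 (ltW dv) (mulr_ge0 (ltW e2) Lv); lra.
Qed.

End SplitFusion.

(** * Inclusion of ellipsoids and the equivalence *)

Lemma ellipsoid_le {R : realType} {n : nat} (P Q : 'M[R]_n) :
  (forall x : 'cV[R]_n, qf (invmx Q) x <= qf (invmx P) x) ->
  ellipsoid P `<=` ellipsoid Q.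
Proof. by move=> h x; apply: le_trans. Qed.

(** Scale [x] to the boundary of [ellipsoid P], apply the inclusion there, and use homogeneity. *)
Lemma ellipsoid_subset {R : realType} {n : nat} (P Q : 'M[R]_n) :
  sym_pd (invmx P) -> ellipsoid P `<=` ellipsoid Q ->
  forall x : 'cV[R]_n, qf (invmx Q) x <= qf (invmx P) x.
Proof.
move=> pP PQ x; have [->|/(pd_gt0 _ pP) x0] := eqVneq x 0; first by rewrite !qfE !bf0l.
pose r := (Num.sqrt (qf (invmx P) x))^-1.
have r2 : r ^+ 2 = (qf (invmx P) x)^-1 by rewrite exprVn sqr_sqrtr // ltW.
have qfr A : qf A (r *: x) = qf A x / qf (invmx P) x.
  by rewrite qfE bfZl bfZr mulrA -expr2 r2 mulrC.
have := PQ (r *: x); rewrite /ellipsoid /= !qfr divff ?gt_eqF // => /(_ (lexx _)).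
by rewrite ler_pdivrMr // mul1r.
Qed.

Theorem theorem4 (R : realType) (n : nat) (PA PB QA QB : 'M[R]_n) (w1 : R) :
  (0 < n)%N ->
  sym_pd PA -> sym_pd PB -> sym_pd QA -> sym_pd QB ->
  0 <= w1 <= 1 ->
  (tightly_circumscribes (B_SCI PA PB QA QB w1) (V_star PA PB QA QB) <->
   exists x : 'cV[R]_n, x != 0 /\ g_fun PA PB QA QB x = qf (H_SCI PA PB QA QB w1) x).
Proof.
move=> n0 hPA hPB hQA hQB hw.
have V_sub w : 0 <= w <= 1 ->
    V_star PA PB QA QB `<=` ellipsoid (invmx (H_SCI PA PB QA QB w)).
  move=> hw' x [M hM]; rewrite /ellipsoid /= invmxK; apply: le_trans.
  exact: M_F_star_ge_H_SCI.
split=> [[_ tight]|[x0 [x0N0 gE]]].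
  apply: contrapT => nex.
  have nc x : x != 0 -> ~ contact PA PB QA QB w1 x.
    move=> xN0 cx; apply: nex; exists x; split=> //; apply: le_anti.
    have [M hM hm] := contact_attained _ _ _ _ hPA hPB hQA hQB _ hw _ xN0 cx.
    by rewrite g_fun_ge_H_SCI // andbT; apply: le_trans hm; apply: g_fun_le.
  have [sg hsg Spos] := slope_mx_definite _ _ _ _ hPA hPB _ n0 hw nc.
  have [w' hw' lt_H] := H_SCI_improve _ _ _ _ hPA hPB hQA hQB _ _ hw hsg Spos.
  have [x xN0] := cV_neq0 R _ n0.
  have H_pd := H_SCI_pd _ _ _ _ hPA hPB hQA hQB _ hw'.
  (* The ellipsoid at [w'] contains [V_star] and lies inside the one at [w1]; tightness makes them
     equal, against the strict [lt_H]. *)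
  have /(congr1 invmx) : invmx (H_SCI PA PB QA QB w') = B_SCI PA PB QA QB w1.
    apply: tight; [exact: pd_inv | exact: V_sub | apply: ellipsoid_le => y].
    rewrite !invmxK.
    by have [->|/lt_H/ltW//] := eqVneq y 0; rewrite !qfE !bf0l.
  by rewrite !invmxK => HE; have := lt_H _ xN0; rewrite HE ltxx.
split=> [|Q Q_pd VQ QsubB]; first exact: V_sub.
have iQ_pd := pd_inv _ Q_pd; have H_pd := H_SCI_pd _ _ _ _ hPA hPB hQA hQB _ hw.
have H_le x : qf (H_SCI PA PB QA QB w1) x <= qf (invmx Q) x.
  by have := ellipsoid_subset _ _ iQ_pd QsubB x; rewrite invmxK.
have le_M M x : A_Split PA PB M -> qf (invmx Q) x <= qf (M_F_star PA PB QA QB M) x.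
  move=> hM; apply: ellipsoid_subset => [|y hy]; first exact: M_F_star_pd.
  by apply: VQ; exists M.
rewrite /B_SCI -[LHS]invmxK; congr invmx; apply/eqP; rewrite -subr_eq0; apply/eqP.
(* Applied with [D] equal to [invmx Q - H_SCI PA PB QA QB w1], which the two inclusions place
   between zero and the gap. *)
apply: (contact_gap_eq0 PA PB QA QB hPA hPB hQA hQB w1 _ x0 hw) => //.
- by rewrite linearB /= !pd_sym.
- by move=> z; rewrite qfE bf_addmx bf_oppmx subr_ge0; exact: H_le.
- by move=> M z hM; rewrite qfE bf_addmx bf_oppmx lerD2r; exact: le_M.
- exact: (contact_of_g_fun_eq _ _ _ _ hPA hPB hQA hQB).
Qed.
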